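(* Suppose $(X,\mathcal{A},d)$ is a complete $C^*$-algebra valued metric space and $T:X\to X$ is a $C^*$-algebra valued contraction. Then $T$ has a unique fixed point $p\in X$.
   Context: Let $X$ be a nonempty set and $\mathcal{A}$ a unital $C^*$-algebra with norm $\|\cdot\|$; $\leq$ denotes the usual order on self-adjoint elements of $\mathcal{A}$ ($a\le b$ iff $b-a$ is positive). A function $d:X\times X\to\mathcal{A}$ is a $C^*$-algebra valued metric on $X$ if: (a) $d(x,y)\geq 0$ for all $x,y\in X$, and $d(x,y)=0\Leftrightarrow x=y$; (b) $d(x,y)=d(y,x)$ for all $x,y\in X$; (c) $d(x,y)\leq d(x,z)+d(z,y)$ for all $x,y,z\in X$. Then $(X,\mathcal{A},d)$ is called a $C^*$-algebra valued metric space. A function $T:X\to X$ is a $C^*$-algebra valued contraction if there exists $A\in\mathcal{A}$ with $\|A\|<1$ and $d(Tx,Ty)\leq A^*d(x,y)A$ for every $x,y\in X$. A sequence $\{x_n\}$ in $X$ converges to $x\in X$ if $\|d(x_n,x)\|\to 0$; it is Cauchy if for every $\varepsilon>0$ there is $N$ such that $\|d(x_n,x_m)\|\leq\varepsilon$ for all $n,m>N$. The space $(X,\mathcal{A},d)$ is complete if every Cauchy sequence in $X$ converges to a point of $X$. *)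

(* Defs.v *)
From HB Require Import structures.
From mathcomp Require Import all_boot all_order all_algebra.
From mathcomp Require Import all_classical all_reals all_analysis.
From mathcomp Require Import complex.

Set Implicit Arguments.
Unset Strict Implicit.
Unset Printing Implicit Defensive.

Import Order.TTheory GRing.Theory Num.Theory.
Import numFieldNormedType.Exports.

Local Open Scope classical_set_scope.
Local Open Scope ring_scope.

(* Unital C*-algebras over R[i]; 1 = 0, i.e. the zero algebra, is allowed.
   The product and the unit are fields, and the ring structure is recovered
   below as an instance, because Hierarchy-Builder rejects a structure that
   inherits from both pzRingType and normedModType (numDomainType already
   joins a ring with a norm). *)
HB.mixin Record isCStarAlgebra (R : realType) A
    of CompleteNormedModule R[i] A := {
  cstar_mul : A -> A -> A;
  cstar_one : A;
  star : A -> A;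
  cstar_mulA : associative cstar_mul;
  cstar_mul1l : left_id cstar_one cstar_mul;
  cstar_mul1r : right_id cstar_one cstar_mul;
  cstar_mulDl : left_distributive cstar_mul +%R;
  cstar_mulDr : right_distributive cstar_mul +%R;
  cstar_scalel : forall (k : R[i]) (x y : A),
    cstar_mul (k *: x) y = k *: cstar_mul x y;
  cstar_scaler : forall (k : R[i]) (x y : A),
    cstar_mul x (k *: y) = k *: cstar_mul x y;
  cstar_normM : forall x y : A, `|cstar_mul x y| <= `|x| * `|y|;
  starK : involutive star;
  starD : forall x y : A, star (x + y) = star x + star y;
  starZ : forall (k : R[i]) (x : A), star (k *: x) = conjc k *: star x;
  starM : forall x y : A, star (cstar_mul x y) = cstar_mul (star y) (star x);
  norm_starM : forall x : A, `|cstar_mul (star x) x| = `|x| ^+ 2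
}.

#[short(type="cstarAlgType")]
HB.structure Definition CStarAlgebra (R : realType) :=
  {A of CompleteNormedModule R[i] A & isCStarAlgebra R A}.

HB.instance Definition _ (R : realType) (A : cstarAlgType R) :=
  GRing.Zmodule_isPzRing.Build A (@cstar_mulA R A) (@cstar_mul1l R A)
    (@cstar_mul1r R A) (@cstar_mulDl R A) (@cstar_mulDr R A).

Section CStarAlgebraTheory.
Variables (R : realType) (A : cstarAlgType R).
Implicit Types a b : A.

(* The library norm of a takes its (nonnegative real) values in R[i]. *)
Definition rnorm a : R := complex.Re `|a|.

Definition invertible a : Prop := exists b, a * b = 1 /\ b * a = 1.

Definition spectrum a : set R[i] := [set k | ~ invertible (a - k *: (1 : A))].

Definition self_adjoint a : Prop := star a = a.

(* In R[i], 0 <= k means that k is real and nonnegative. *)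
Definition positive a : Prop :=
  self_adjoint a /\ spectrum a `<=` [set k | 0 <= k].

Definition cstar_le a b : Prop := positive (b - a).

End CStarAlgebraTheory.

Section CStarMetric.
Variables (R : realType) (A : cstarAlgType R) (X : Type) (d : X -> X -> A).

Record cstar_metric : Prop := CStarMetric {
  cstar_metric_ge0 : forall x y, cstar_le 0 (d x y);
  cstar_metric_eq0 : forall x y, d x y = 0 <-> x = y;
  cstar_metric_sym : forall x y, d x y = d y x;
  cstar_metric_triangle : forall x y z, cstar_le (d x y) (d x z + d z y)
}.

Definition cstar_cvg (u : nat -> X) (x : X) : Prop :=
  rnorm (d (u n) x) @[n --> \oo] --> (0 : R).

Definition cstar_cauchy (u : nat -> X) : Prop :=
  forall e : R, 0 < e -> exists N : nat, forall n m : nat,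
    (N < n)%N -> (N < m)%N -> rnorm (d (u n) (u m)) <= e.

Definition cstar_complete : Prop :=
  forall u : nat -> X, cstar_cauchy u -> exists x, cstar_cvg u x.

Definition cstar_contraction (T : X -> X) : Prop :=
  exists a : A, rnorm a < 1 /\
    forall x y, cstar_le (d (T x) (T y)) (star a * d x y * a).

End CStarMetric.

(* Main.v *)
Require Import Defs.
From mathcomp Require Import all_boot all_order all_algebra.
From mathcomp Require Import all_classical all_reals all_analysis.
From mathcomp Require Import complex ring lra.

(* The norm is monotone on positive elements, so [rnorm (d x y)] is an ordinary
   complete metric for which [T] is a contraction of ratio [rnorm a ^+ 2], and
   Banach's theorem applies.  Monotonicity only needs that the norm of a
   self-adjoint element is at most its spectral radius: then a self-adjoint [a]
   with [rnorm a <= t] is positive iff [rnorm (t - a) <= t], so sums of positive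
   elements are positive, and [a <= b] puts the spectrum of [a] below [rnorm b].

   The spectral radius bound is obtained without complex analysis, by a variant
   of Rickart's argument.  Suppose [h] is self-adjoint of norm 1 and
   [1 - h], [1 + h] are invertible.  Then the resolvents [(1 - z h)^-1] are
   uniformly bounded on the circle [|z| = 1], hence uniformly close to
   [(1 - z s h)^-1] for some real [s < 1].  Averaging over the square roots of
   [z] carries this closeness over to the powers [h ^ (2 ^ n)] and
   [(s h) ^ (2 ^ n)]; but the former have norm 1 and the latter tend to 0. *)

Set Implicit Arguments.
Unset Strict Implicit.
Unset Printing Implicit Defensive.

Import Order.TTheory GRing.Theory Num.Theory.
Import numFieldNormedType.Exports.
Import Normc.

Local Open Scope classical_set_scope.
Local Open Scope ring_scope.
Local Open Scope complex_scope.

(** * Banach's fixed point theorem for a real-valued metric *)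

Section BanachFixedPoint.
Variables (R : realType) (X : Type) (D : X -> X -> R).
Hypothesis D_ge0 : forall x y, 0 <= D x y.
Hypothesis D_eq0 : forall x y, D x y = 0 <-> x = y.
Hypothesis D_sym : forall x y, D x y = D y x.
Hypothesis D_tri : forall x y z, D x y <= D x z + D z y.
Hypothesis D_complete : forall u : nat -> X,
  (forall e : R, 0 < e -> exists N : nat, forall n m : nat,
     (N < n)%N -> (N < m)%N -> D (u n) (u m) <= e) ->
  exists x, D (u n) x @[n --> \oo] --> (0 : R).

Lemma banach_fixed_point_dist (T : X -> X) (q : R) : inhabited X ->
  0 <= q -> q < 1 -> (forall x y, D (T x) (T y) <= q * D x y) ->
  exists! p, T p = p.
Proof.
case=> x0 q0 q1 HT.
have fix_eq p p' : T p = p -> T p' = p' -> p = p'.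
  move=> Tp Tp'; apply/D_eq0; have := HT p p'; rewrite Tp Tp'.
  by have := D_ge0 p p'; nra.
pose u n := iter n T x0.
(* The geometric-series bound on the distance from [x0] to any iterate; [CE] is the recursion that
   drives the induction in [u0]. *)
pose C := D x0 (T x0) / (1 - q).
have C0 : 0 <= C by rewrite divr_ge0 ?D_ge0// subr_ge0 ltW.
have CE : C = q * C + D x0 (T x0) by rewrite /C; field; lra.
have D00 x : D x x = 0 by apply/D_eq0.
have u0 m : D x0 (u m) <= C.
  elim: m => [|m IH]; first by rewrite D00.
  apply: (le_trans (D_tri _ _ (T x0))).
  rewrite [leRHS]CE addrC lerD2r.
  by rewrite (le_trans (HT _ _))// ler_wpM2l.
have ud n m : D (u n) (u (n + m)%N) <= C * q ^+ n.
  elim: n => [|n IH]; first by rewrite expr0 mulr1.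
  rewrite addSn (le_trans (HT _ _))// exprS mulrCA ler_wpM2l//.
have qn := @cvg_geometric R C q (etrans (congr1 (fun x => x < 1) (ger0_norm q0)) q1).
have /D_complete[p up] : forall e : R, 0 < e -> exists N : nat, forall n m : nat,
     (N < n)%N -> (N < m)%N -> D (u n) (u m) <= e.
  move=> e e0.
  have /cvgr0_norm_le/(_ _ e0)[N _ HN] := qn.
  have wlg n m : (N < n)%N -> (n <= m)%N -> D (u n) (u m) <= e.
    move=> Nn nm; rewrite -(subnKC nm) (le_trans (ud _ _))//.
    by rewrite (le_trans (ler_norm _))// HN//= ltnW.
  exists N => n m Nn Nm; case: (leqP n m) => nm; first exact: wlg.
  by rewrite D_sym wlg// ltnW.
suff Tp : T p = p by exists p; split=> // p'; exact: fix_eq.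
apply/D_eq0/le_anti; rewrite D_ge0 andbT.
apply/ler_addgt0Pr => e e0; rewrite add0r.
have e2 : 0 < e / 2 by rewrite divr_gt0.
have /cvgr0_norm_le/(_ _ e2)[N _ HN] := up.
have le_e n : (N <= n)%N -> D (u n) p <= e / 2.
  by move=> Nn; rewrite (le_trans (ler_norm _))// HN.
apply: (le_trans (D_tri _ _ (u N.+1))).
have := HT p (u N); have := le_e _ (leqnn N); have := le_e _ (leqnSn N).
by rewrite /u/= -/(u N) (D_sym p (u N)); have := D_ge0 (u N) p; nra.
Qed.

End BanachFixedPoint.

(** * Norm, inverses and the Neumann lemma in a C*-algebra *)

Section Algebra.
Variables (R : realType) (A : cstarAlgType R).
Implicit Types (a b g h x y : A) (k z : R[i]).

Lemma rnormE x : `|x| = (rnorm x)%:C.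
Proof. by rewrite RRe_real// ger0_real. Qed.

Lemma rnorm_ge0 x : 0 <= rnorm x.
Proof. by rewrite -ler0c -rnormE. Qed.

Lemma rnorm_eq0 x : rnorm x = 0 <-> x = 0.
Proof.
split=> [x0|->]; last by rewrite /rnorm normr0.
by apply/normr0_eq0; rewrite rnormE x0.
Qed.

Lemma rnormD x y : rnorm (x + y) <= rnorm x + rnorm y.
Proof. by rewrite -lecR rmorphD/= -!rnormE ler_normD. Qed.

Lemma rnormN x : rnorm (- x) = rnorm x.
Proof. by rewrite /rnorm normrN. Qed.

Lemma rnormB x y : rnorm (x - y) = rnorm (y - x).
Proof. by rewrite /rnorm distrC. Qed.

Lemma rnormM x y : rnorm (x * y) <= rnorm x * rnorm y.
Proof. by rewrite -lecR rmorphM/= -!rnormE; exact: cstar_normM. Qed.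

Lemma rnormZ k x : rnorm (k *: x) = normc k * rnorm x.
Proof. by rewrite /rnorm normrZ rnormE normc_def /= mulr0 subr0; case: k. Qed.

Lemma scaleAl k x y : k *: (x * y) = (k *: x) * y.
Proof. by rewrite [RHS]cstar_scalel. Qed.

Lemma scaleAr k x y : k *: (x * y) = x * (k *: y).
Proof. by rewrite [RHS]cstar_scaler. Qed.

Lemma star_mulE x y : star (x * y) = star y * star x.
Proof. exact: starM. Qed.

Lemma star0 : star (0 : A) = 0.
Proof. by apply: (addrI (star 0)); rewrite -starD !addr0. Qed.

Lemma starN x : star (- x) = - star x.
Proof. by apply: (addrI (star x)); rewrite -starD !subrr star0. Qed.

Lemma starB x y : star (x - y) = star x - star y.
Proof. by rewrite starD starN. Qed.

Lemma star1 : star (1 : A) = 1.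
Proof. by rewrite -[LHS]mulr1 -[X in _ * X]starK -star_mulE mulr1 starK. Qed.

Lemma rnorm_starM x : rnorm (star x * x) = rnorm x ^+ 2.
Proof.
by apply: complexI; rewrite rmorphXn/= -!rnormE; exact: norm_starM.
Qed.

Lemma rnorm_star x : rnorm (star x) = rnorm x.
Proof.
suff le y : rnorm y <= rnorm (star y).
  by apply/le_anti; rewrite le andbT -{2}[x]starK le.
have := rnormM (star y) y; rewrite rnorm_starM.
by have := rnorm_ge0 y; have := rnorm_ge0 (star y); nra.
Qed.

(** The C*-identity gives [rnorm 1 = rnorm 1 ^+ 2]; the value 0 occurs in the zero algebra, hence
    only an inequality. *)
Lemma rnorm1_le1 : rnorm (1 : A) <= 1.
Proof.
have := rnorm_starM 1; rewrite star1 mulr1.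
by have := rnorm_ge0 1; nra.
Qed.

Lemma rnormZ1 k : rnorm (k *: (1 : A)) <= normc k.
Proof. by rewrite rnormZ ler_piMr ?rnorm1_le1// -ler0c -[_%:C]/(`|k|). Qed.

Definition inverse_of a b : Prop := a * b = 1 /\ b * a = 1.

Lemma inverse_ofM a b g h : inverse_of a g -> inverse_of b h ->
  inverse_of (a * b) (h * g).
Proof.
move=> [ag ga] [bh hb]; split.
  by rewrite mulrA -(mulrA a) bh mulr1.
by rewrite mulrA -(mulrA h) ga mulr1.
Qed.

Lemma inverse_ofZ k a g : k != 0 -> inverse_of a g ->
  inverse_of (k *: a) (k^-1 *: g).
Proof.
by move=> k0 [ag ga]; split; rewrite -scaleAl -scaleAr scalerA;
  rewrite (mulfV, mulVf)// scale1r.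
Qed.

Lemma inverse_of_star a g : inverse_of a g -> inverse_of (star a) (star g).
Proof. by move=> [ag ga]; split; rewrite -star_mulE ?ag ?ga star1. Qed.

Lemma inverse_of_uniq a g g' : inverse_of a g -> inverse_of a g' -> g = g'.
Proof.
by move=> [_ ga] [ag' _]; rewrite -[g]mulr1 -ag' mulrA ga mul1r.
Qed.

(** The resolvent identity, for arbitrary invertible elements. *)
Lemma inverse_ofB a b g h : inverse_of a g -> inverse_of b h ->
  g - h = g * (b - a) * h.
Proof.
by move=> [_ ga] [bh _]; rewrite mulrBr ga mulrBl -mulrA bh mulr1 mul1r.
Qed.

Lemma rnorm_complete (u : nat -> A) :
  (forall e : R, 0 < e -> exists N : nat, forall n m : nat,
     (N < n)%N -> (N < m)%N -> rnorm (u n - u m) <= e) ->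
  exists x, rnorm (u n - x) @[n --> \oo] --> (0 : R).
Proof.
move=> uC.
have /cauchy_exP/cauchy_cvg/cvg_ex[x ux] : cauchy_ex (u @ \oo).
  move=> e; rewrite ltcE/= => /andP[/eqP e0 e1].
  (* A positive [e] in [R[i]] is real; halving it turns the bound [<=] into the strict one of the
     ball. *)
  have [|N HN] := uC (complex.Re e / 2); first by rewrite divr_gt0.
  exists (u N.+1), N.+1 => // n /= Nn.
  rewrite /= -ball_normE /= rnormE ltcE /= e0 eqxx /=.
  by have := HN N.+1 n (leqnn _) Nn; lra.
exists x; apply/cvgr0Pnorm_lt => e e0.
have e0' : 0 < e%:C by rewrite ltcR.
have /cvgrPdist_lt/(_ _ e0') := ux; apply: filterS => n.
by rewrite rnormE ltcR rnormB ger0_norm// rnorm_ge0.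
Qed.

Lemma rnorm_fixed_point (f : A -> A) (q : R) : 0 <= q -> q < 1 ->
  (forall x y, rnorm (f x - f y) <= q * rnorm (x - y)) -> exists y, f y = y.
Proof.
move=> q0 q1 fq.
have [||||y [fy _]] := @banach_fixed_point_dist R A (fun x y => rnorm (x - y))
   _ _ _ _ rnorm_complete f q (inhabits 0) q0 q1 fq; last by exists y.
- by move=> x y; exact: rnorm_ge0.
- by move=> x y; rewrite rnorm_eq0; split=> [/subr0_eq|->]; rewrite ?subrr.
- exact: rnormB.
- by move=> x y z; rewrite -[x - y](subrKA z) rnormD.
Qed.

(** The fixed points of [y => 1 + x * y] and [y => 1 + y * x], contractions of ratio [rnorm x], are
    a right and a left inverse of [1 - x], so no series is summed. *)
Lemma neumann x : rnorm x < 1 ->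
  exists2 g, inverse_of (1 - x) g & rnorm g <= (1 - rnorm x)^-1.
Proof.
move=> x1.
have [|y yE] := @rnorm_fixed_point (fun y => 1 + x * y) _ (rnorm_ge0 x) x1.
  by move=> y z; rewrite opprD addrACA subrr add0r -mulrBr rnormM.
have [|z zE] := @rnorm_fixed_point (fun y => 1 + y * x) _ (rnorm_ge0 x) x1.
  by move=> y' z; rewrite opprD addrACA subrr add0r -mulrBl mulrC rnormM.
have y1 : (1 - x) * y = 1 by rewrite mulrBl mul1r -{1}yE addrK.
have z1 : z * (1 - x) = 1 by rewrite mulrBr mulr1 -{1}zE addrK.
have zy : z = y by rewrite -[z]mulr1 -y1 mulrA z1 mul1r.
exists y; first by split=> //; rewrite -zy.
have := rnormD 1 (x * y); rewrite yE.
have := rnormM x y; have := rnorm1_le1 => *.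
by rewrite -div1r ler_pdivlMr ?subr_gt0//; nra.
Qed.

(** Factor [a - e = a * (1 - g * e)]; by [neumann] the second factor has an inverse of norm at most
    2. *)
Lemma inverse_of_perturb a e g : inverse_of a g ->
  rnorm g * rnorm e <= 2^-1 ->
  exists2 g', inverse_of (a - e) g' & rnorm g' <= 2 * rnorm g.
Proof.
move=> ag ge; have ge2 : rnorm (g * e) <= 2^-1 := le_trans (rnormM _ _) ge.
have [|w we wn] := @neumann (g * e); first by lra.
exists (w * g).
  by have := inverse_ofM ag we; rewrite mulrBr mulr1 mulrA ag.1 mul1r.
rewrite (le_trans (rnormM _ _))// ler_wpM2r ?rnorm_ge0// (le_trans wn)//.
by rewrite invf_ple ?posrE; lra.
Qed.

Lemma spectrumP k a : ~ spectrum a k <-> exists g, inverse_of (a - k *: (1 : A)) g.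
Proof. by split=> [/contrapT|/[swap]]. Qed.

Lemma spectrum_norm k a : spectrum a k -> normc k <= rnorm a.
Proof.
move=> ak; rewrite leNgt; apply/negP => kn; move: ak; apply/spectrumP.
have k0 : 0 < normc k := le_lt_trans (rnorm_ge0 _) kn.
have k00 : k != 0 by apply: contraTneq k0 => ->; rewrite normc0 ltxx.
have [|g ag _] := @neumann (k^-1 *: a).
  by rewrite rnormZ normcV mulrC ltr_pdivrMr ?mul1r.
have nk0 : - k != 0 by rewrite oppr_eq0.
exists ((- k)^-1 *: g); have := inverse_ofZ nk0 ag.
by rewrite scalerBr scalerA mulNr mulfV// scaleN1r opprK scaleNr addrC.
Qed.

End Algebra.

(** * Real spectrum and spectral radius of self-adjoint elements *)

Section SpectralRadius.
Variables (R : realType) (A : cstarAlgType R).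
Implicit Types (a b g h u x y : A) (k z : R[i]).

Lemma normc_ge0 k : 0 <= normc k.
Proof. by case: k => x y; exact: sqrtr_ge0. Qed.

Lemma normc_sqrE k : normc k ^+ 2 = complex.Re k ^+ 2 + complex.Im k ^+ 2.
Proof. by case: k => x y; rewrite sqr_sqrtr// addr_ge0// sqr_ge0. Qed.

Lemma spectrumD a k z : spectrum a k -> spectrum (a + z *: (1 : A)) (k + z).
Proof. by rewrite /spectrum/= [k + z]addrC scalerDl opprD addrA addrK. Qed.

Lemma spectrumN a k : spectrum a k -> spectrum (- a) (- k).
Proof.
move=> ak; apply: contrapT => /spectrumP[g ag]; move: ak; apply/spectrumP.
have /(inverse_ofZ)/(_ ag) : (-1 : R[i]) != 0 by rewrite oppr_eq0 oner_eq0.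
by rewrite scaleN1r opprB scaleNr opprK addrC => ?; eexists; eassumption.
Qed.

(* Arens: shift [h] by a large imaginary multiple of [1]. *)
Lemma spectrum_self_adjoint_real h k : self_adjoint h -> spectrum h k ->
  complex.Im k = 0.
Proof.
case: k => s t hs hk /=; apply/eqP/negPn/negP => t0.
pose n2 := rnorm h ^+ 2.
(* The left side is [|k + i l|^2], at most [|h + i l|^2 = |h^2 + l^2|] by the C*-identity. *)
have key (l : R) : s ^+ 2 + (t + l) ^+ 2 <= n2 + l ^+ 2.
  have /spectrum_norm := @spectrumD _ _ (0 +i* l) hk.
  rewrite -(@ler_pXn2r _ 2) ?nnegrE ?normc_ge0 ?rnorm_ge0//.
  rewrite normc_sqrE /= addr0 => /le_trans; apply.
  rewrite -rnorm_starM starD starZ star1 hs.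
  have -> : (h + (0 +i* l)^* *: (1 : A)) * (h + (0 +i* l) *: (1 : A)) =
            h * h + (l ^+ 2)%:C *: (1 : A).
    rewrite mulrDl !mulrDr -!scaleAl -!scaleAr !mulr1 !mul1r scalerA /=.
    have -> : (0 -i* l) * (0 +i* l) = (l ^+ 2)%:C.
      by apply/eqP; rewrite eq_complex /=; apply/andP; split; apply/eqP; ring.
    rewrite -addrA; congr (_ + _); rewrite addrA -scalerDl.
    by rewrite addcJ /= mulr0 scale0r add0r.
  rewrite (le_trans (rnormD _ _))// -{1}hs rnorm_starM lerD2l.
  rewrite (le_trans (rnormZ1 _ _))// /= expr0n /= addr0 sqrtr_sqr.
  by rewrite ger0_norm ?sqr_ge0.
(* [key] amounts to [s^2 + t^2 + 2 t l <= n2]; this [l] makes [2 t l = n2 + 1]. *)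
have := key ((n2 + 1) / (2 * t)).
have -> : t + (n2 + 1) / (2 * t) = (2 * t ^+ 2 + (n2 + 1)) / (2 * t) by field.
rewrite -subr_ge0.
have -> : n2 + ((n2 + 1) / (2 * t)) ^+ 2 -
   (s ^+ 2 + ((2 * t ^+ 2 + (n2 + 1)) / (2 * t)) ^+ 2) =
   - (s ^+ 2) - t ^+ 2 - 1 by field.
by have := sqr_ge0 s; have := sqr_ge0 t; lra.
Qed.

(* For the resolvent [g] at [k] of a self-adjoint element, the resolvent
   identity gives [g - g^* = (k - k^* ) g g^*]; take norms. *)
Lemma rnorm_resolvent h k g : self_adjoint h ->
  inverse_of (h - k *: (1 : A)) g -> `|complex.Im k| * rnorm g <= 1.
Proof.
move=> hs hg; have := inverse_ofB hg (inverse_of_star hg).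
rewrite starB starZ star1 hs [_ - _ - _]addrC opprB addrA subrK -scalerBl.
rewrite -scaleAr -scaleAl mulr1 => gE.
have : rnorm (g - star g) <= 2 * rnorm g.
  by rewrite (le_trans (rnormD _ _))// rnormN rnorm_star; lra.
rewrite gE rnormZ -{1}[g]starK rnorm_starM rnorm_star subcJ.
have -> : 2 * (complex.Im k)%:C * 'i = 0 +i* (2 * complex.Im k).
  by apply/eqP; rewrite eq_complex /=; apply/andP; split; apply/eqP; ring.
rewrite /normc expr0n add0r sqrtr_sqr normrM ger0_norm//.
have := rnorm_ge0 g; have := normr_ge0 (complex.Im k).
(* The bound so far is [2 m r^2 <= 2 r]; divide by [r] unless it is 0. *)
set m := `|_|; set r := rnorm g => m0 r0; have [->|r1] := eqVneq r 0; nra.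
Qed.
(** Near [z = 1] and [z = -1], perturb [g1] and [g2]; on the remaining arcs the imaginary part of
    [z] stays away from 0 and [rnorm_resolvent] applies. *)
Lemma resolvent_circle_bounded h g1 g2 : self_adjoint h -> rnorm h = 1 ->
  inverse_of (1 - h) g1 -> inverse_of (1 + h) g2 ->
  exists2 M : R, 1 <= M & forall z, normc z = 1 ->
    exists2 g, inverse_of (1 - z *: h) g & rnorm g <= M.
Proof.
move=> hs h1 hg1 hg2.
have r1 := rnorm_ge0 g1; have r2 := rnorm_ge0 g2.
(* [m] bounds both inverses, and [m * d = 1/2] is the threshold of [inverse_of_perturb]. *)
pose m := rnorm g1 + rnorm g2 + 1; pose d := (2 * m)^-1.
have d0 : 0 < d by rewrite invr_gt0; rewrite /m; lra.
have md : m * d = 2^-1 by rewrite /d; field; rewrite /m; lra.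
have M0 : 0 <= 2 / d ^+ 2 by rewrite divr_ge0// sqr_ge0.
exists (2 * m + 2 / d ^+ 2) => [|z z1]; first by rewrite /m; lra.
have near_real (c : R[i]) gc : inverse_of (1 - c *: h) gc ->
    rnorm gc <= m -> normc (z - c) <= d ->
    exists2 g, inverse_of (1 - z *: h) g & rnorm g <= 2 * m + 2 / d ^+ 2.
  move=> hc gm zd; have [|g] := @inverse_of_perturb _ _ _ ((z - c) *: h) _ hc.
    rewrite rnormZ h1 mulr1 -md ler_pM ?rnorm_ge0 ?normc_ge0//.
  by rewrite -addrA -opprD -scalerDl subrKC => gi gn; exists g => //; lra.
have [zd|zd] := leP (normc (z - 1)) d.
  by apply: near_real zd; [rewrite scale1r; exact: hg1|rewrite /m; lra].
have [zd'|zd'] := leP (normc (z + 1)) d.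
  apply: (near_real (-1) g2) => //; last by rewrite opprK.
    by rewrite scaleN1r opprK.
  by rewrite /m; lra.
have := normc_sqrE z; rewrite z1 expr1n.
have : d ^+ 2 < normc (z - 1) ^+ 2 by rewrite ltrXn2r// ltW.
have : d ^+ 2 < normc (z + 1) ^+ 2 by rewrite ltrXn2r// ltW.
rewrite !normc_sqrE; case: z z1 {near_real zd zd'} => s t z1 /=; rewrite !addr0 oppr0 addr0.
move=> dp dm st1.
(* [t^2 = (1 - s) (1 + s)], and both factors exceed [d^2 / 2] since [|z - 1|^2 = 2 (1 - s)] and
   [|z + 1|^2 = 2 (1 + s)]. *)
have t2 : (d ^+ 2 / 2) ^+ 2 <= t ^+ 2 by nra.
have {}t2 : d ^+ 2 / 2 <= `|t|.
  by rewrite -(@ler_pXn2r _ 2) ?nnegrE// ?real_normK ?num_real// divr_ge0 ?sqr_ge0.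
have d2 : 0 < d ^+ 2 by rewrite exprn_gt0.
have tN0 : t != 0 by apply: contraTneq t2 => ->; rewrite normr0; lra.
(* On the circle the conjugate of [z] is [z^-1], so [1 - z h = - z (h - z^-1)] with [z^-1] not
   real. *)
have zJ : (s +i* t) * (s -i* t) = 1.
  by apply/eqP; rewrite eq_complex /=; apply/andP; split; apply/eqP; nra.
have zN0 : - (s +i* t) != 0.
  by rewrite oppr_eq0; apply: contra_eq_neq zJ => ->; rewrite mul0r eq_sym oner_eq0.
have /spectrumP[g hg] : ~ spectrum h (s -i* t).
  by move=> /(spectrum_self_adjoint_real hs) /= /eqP; rewrite oppr_eq0 (negPf tN0).
exists ((- (s +i* t))^-1 *: g).
  have := inverse_ofZ zN0 hg.
  by rewrite scalerBr scalerA mulNr zJ scaleN1r opprK scaleNr addrC.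
rewrite rnormZ normcV normcN z1 invr1 mul1r.
have := rnorm_resolvent hs hg; rewrite /= normrN.
have -> : 2 / d ^+ 2 = (d ^+ 2 / 2)^-1 by field; lra.
have := rnorm_ge0 g; move: (rnorm g) => r r0 tr.
have : r <= (d ^+ 2 / 2)^-1.
  by rewrite -div1r ler_pdivlMr; nra.
rewrite /m; lra.
Qed.

(** A partial fraction identity: [h * (p + q) * g = g + h]. *)
Lemma inverse_of_half p q g h : inverse_of p g -> inverse_of q h ->
  p + q = 2 *: (1 : A) -> h * g = 2^-1 *: (g + h).
Proof.
move=> [pg _] [_ hq] pq.
have -> : g + h = h * (p + q) * g.
  by rewrite mulrDr mulrDl hq mul1r -mulrA pg mulr1 addrC.
by rewrite pq -scaleAr -scaleAl mulr1 scalerA mulVf ?scale1r// pnatr_eq0.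
Qed.

Definition circle_close u u' (e : R) := forall z, normc z = 1 ->
  exists g g', [/\ inverse_of (1 - z *: u) g, inverse_of (1 - z *: u') g' &
                   rnorm (g - g') <= e].

(* With [w ^+ 2 = z], the resolvent [(1 - z u^2)^-1] is the mean of
   [(1 - w u)^-1] and [(1 + w u)^-1]. *)
Lemma circle_close_sqr u u' e :
  circle_close u u' e -> circle_close (u * u) (u' * u') e.
Proof.
move=> uu' z z1; pose w := sqrtc z.
have w2 : w * w = z by rewrite -expr2 sqr_sqrtc.
have w1 : normc w = 1.
  have := normcM w w; rewrite w2 z1.
  by have := normc_ge0 w; nra.
have [g1 [g1' [ug1 ug1' gg1]]] := uu' w w1.
have [|g2 [g2' [ug2 ug2' gg2]]] := uu' (- w); first by rewrite normcN.
have fact (v : A) : (1 - w *: v) * (1 - - w *: v) = 1 - z *: (v * v).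
  rewrite scaleNr opprK mulrDr mulr1 mulrBl mul1r addrA subrK.
  by rewrite -scaleAl -scaleAr scalerA w2.
have sum2 (v : A) : (1 - w *: v) + (1 - - w *: v) = 2 *: (1 : A).
  by rewrite scaleNr opprK addrACA addNr addr0 scaler_nat.
exists (g2 * g1), (g2' * g1'); split.
- by rewrite -fact; exact: inverse_ofM.
- by rewrite -fact; exact: inverse_ofM.
rewrite (inverse_of_half ug1 ug2 (sum2 u)) (inverse_of_half ug1' ug2' (sum2 u')).
rewrite -scalerBr rnormZ opprD addrACA.
have -> : normc (2^-1 : R[i]) = 2^-1.
  by rewrite normcV -[2]/(2%:R) normcMn normc1.
have := rnormD (g1 - g1') (g2 - g2'); lra.
Qed.

Lemma circle_close_iter u u' e n : circle_close u u' e ->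
  circle_close (iter n (fun x => x * x) u) (iter n (fun x => x * x) u') e.
Proof. by move=> uu'; elim: n => // n IH; apply: circle_close_sqr. Qed.

Lemma self_adjoint_iter_sqr h n : self_adjoint h ->
  self_adjoint (iter n (fun x => x * x) h).
Proof.
by move=> hs; elim: n => //= n IH; rewrite /self_adjoint star_mulE !IH.
Qed.

Lemma rnorm_iter_sqr_self_adjoint h n : self_adjoint h ->
  rnorm (iter n (fun x => x * x) h) = rnorm h ^+ (2 ^ n).
Proof.
move=> hs; elim: n => //= n IH.
by rewrite -{1}(self_adjoint_iter_sqr n hs) rnorm_starM IH -exprM -expnSr.
Qed.

Lemma rnorm_iter_sqr_le x n :
  rnorm (iter n (fun x => x * x) x) <= rnorm x ^+ (2 ^ n).
Proof.
elim: n => //= n IH; rewrite (le_trans (rnormM _ _))// expnSr exprM expr2.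
by rewrite ler_pM ?rnorm_ge0.
Qed.

Lemma rnorm1_not_inverse h g1 g2 : self_adjoint h -> rnorm h = 1 ->
  inverse_of (1 - h) g1 -> inverse_of (1 + h) g2 -> False.
Proof.
move=> hs h1 hg1 hg2.
have [M M1 HM] := resolvent_circle_bounded hs h1 hg1 hg2.
(* The resolvents will differ by at most [M * (1 - s) * (2 * M)], which this choice makes [1/8]. *)
pose s := 1 - (16 * M ^+ 2)^-1.
have sE : (1 - s) * (16 * M ^+ 2) = 1 by rewrite /s; field; lra.
have [s0 s1] : 0 < s /\ s < 1.
  by split; nra.
clearbody s.
have close : circle_close h (s%:C *: h) 8^-1.
  move=> z z1; have [g zg gM] := HM z z1.
  have nz : rnorm ((z * (s - 1)%:C) *: h) = 1 - s.
    rewrite rnormZ h1 mulr1 normcM z1 mul1r /= expr0n /= addr0 sqrtr_sqr.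
    by rewrite distrC ger0_norm//; lra.
  have r0 := rnorm_ge0 g.
  have [|g' zg' g'M] := @inverse_of_perturb _ _ _ ((z * (s - 1)%:C) *: h) _ zg.
    by rewrite nz; nra.
  exists g, g'; split=> //.
    suff -> : 1 - z *: (s%:C *: h) = 1 - z *: h - (z * (s - 1)%:C) *: h by [].
    rewrite -addrA -opprD -scalerDl scalerA; congr (_ - _ *: _).
    by rewrite rmorphB rmorph1 mulrBr mulr1 subrKC.
  rewrite (inverse_ofB zg zg') [_ - _ - _]addrAC subrr add0r mulrN mulNr rnormN.
  rewrite (le_trans (rnormM _ _))//.
  have := rnormM g ((z * (s - 1)%:C) *: h); rewrite nz.
  have t0 := rnorm_ge0 (g * ((z * (s - 1)%:C) *: h)) => gE.
  have : rnorm (g * ((z * (s - 1)%:C) *: h)) <= M * (1 - s) by nra.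
  have : rnorm g' <= 2 * M by lra.
  move=> g'le gEle; apply: (le_trans (ler_pM t0 (rnorm_ge0 _) gEle g'le)).
  nra.
have [N sN] : exists N, s ^+ (2 ^ N) <= 10^-1.
  have : s ^+ n @[n --> \oo] --> (0 : R) by apply: cvg_expr; rewrite ger0_norm// ltW.
  have e0 : 0 < 10^-1 :> R by rewrite invr_gt0.
  move=> /cvgr0_norm_le/(_ _ e0)[N _ HN]; exists N.
  by rewrite (le_trans (ler_norm _))// HN//= ltnW// ltn_expl.
(* At [z = 1], [u'] small gives [|g' - 1| <= 1/9], so [|g - 1| <= 1/9 + 1/8 <= 1/4]; then
   [u = (1 - u) (g - 1)] has norm at most [1/2], against [rnorm u = 1]. *)
have [|g [g' []]] := circle_close_iter N close (z := 1).
  exact: normc1.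
set u := iter _ _ h; set u' := iter _ _ _; rewrite !scale1r => ug ug' gg'.
have un : rnorm u = 1 by rewrite rnorm_iter_sqr_self_adjoint// h1 expr1n.
have un' : rnorm u' <= 10^-1.
  rewrite (le_trans (rnorm_iter_sqr_le _ _))// rnormZ h1 mulr1 /=.
  by rewrite expr0n /= addr0 sqrtr_sqr ger0_norm// ltW.
have minus1 (v w : A) : inverse_of (1 - v) w -> w - 1 = w * v.
  by move=> [_ wv]; rewrite -wv mulrBr mulr1 subKr.
have g'1 : rnorm (g' - 1) <= 9^-1.
  have [|w ug'' wn] := @neumann _ _ u'; first by lra.
  rewrite (minus1 _ _ ug') (le_trans (rnormM _ _))//.
  rewrite (inverse_of_uniq ug' ug'').
  have : rnorm w <= 10 / 9.
    by rewrite (le_trans wn)// -div1r ler_pdivrMr; lra.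
  by have := rnorm_ge0 w; have := rnorm_ge0 u'; nra.
have g1' : rnorm (g - 1) <= 4^-1.
  by have := rnormD (g - g') (g' - 1); rewrite addrA subrK; lra.
have uE : u = (1 - u) * (g - 1).
  by rewrite (minus1 _ _ ug) mulrA ug.1 mul1r.
have := rnormM (1 - u) (g - 1); rewrite -uE un.
have := rnormD 1 (- u); rewrite rnormN un.
have := rnorm1_le1 A; have := rnorm_ge0 (g - 1); have := rnorm_ge0 (1 - u).
nra.
Qed.

(** If [c = rnorm a] exceeded [r], neither [c] nor [- c] would be in the spectrum, and [a / c] would
    contradict [rnorm1_not_inverse]. *)
Lemma rnorm_le_spectrum a (r : R) : self_adjoint a -> 0 <= r ->
  (forall k, spectrum a k -> normc k <= r) -> rnorm a <= r.
Proof.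
move=> hs r0 ar; rewrite leNgt; apply/negP => ra.
pose c := rnorm a; have c0 : 0 < c := le_lt_trans r0 ra.
have cC : c%:C != 0 by rewrite eq_complex /= eqxx andbT gt_eqF.
have nc : normc c%:C = c by rewrite /= expr0n /= addr0 sqrtr_sqr gtr0_norm.
have /spectrumP[g1 ag1] : ~ spectrum a c%:C by move=> /ar; rewrite nc leNgt ra.
have /spectrumP[g2 ag2] : ~ spectrum a (- c%:C).
  by move=> /ar; rewrite normcN nc leNgt ra.
apply: (@rnorm1_not_inverse (c%:C^-1 *: a) ((- c%:C^-1)^-1 *: g1)
  (c%:C^-1^-1 *: g2)).
- by rewrite /self_adjoint starZ hs conjc_inv conjc_real.
- by rewrite rnormZ normcV nc mulVf ?gt_eqF.
- have := @inverse_ofZ _ _ (- c%:C^-1) _ _ _ ag1.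
  by rewrite oppr_eq0 invr_eq0 => /(_ cC); rewrite scalerBr scalerA mulNr mulVf//
    scaleN1r opprK scaleNr addrC.
- have := @inverse_ofZ _ _ (c%:C^-1) _ _ _ ag2.
  by rewrite invr_eq0 => /(_ cC); rewrite scalerBr scalerA mulrN mulVf//
    scaleN1r opprK addrC.
Qed.

End SpectralRadius.

(** * Positive elements and monotonicity of the norm *)

Section Positivity.
Variables (R : realType) (A : cstarAlgType R).
Implicit Types (a b x y : A) (k z : R[i]) (t : R).

Lemma self_adjoint_real_sub t a : self_adjoint a ->
  self_adjoint (t%:C *: (1 : A) - a).
Proof. by move=> ha; rewrite /self_adjoint starB starZ conjc_real star1 ha. Qed.

Lemma spectrum_sub z a k : spectrum (z *: (1 : A) - a) k <-> spectrum a (z - k).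
Proof.
split=> [/(spectrumD (z := - z))/spectrumN|/spectrumN/(spectrumD (z := z))].
  by rewrite scaleNr addrAC subrr add0r opprK opprB.
by rewrite opprB subrK addrC.
Qed.

(** For real [k] in [[-t, t]], [0 <= k] iff [|t - k| <= t]; apply this on the spectrum. Unlike the
    spectral condition, the norm condition visibly passes to sums. *)
Lemma positiveP a t : self_adjoint a -> rnorm a <= t ->
  positive a <-> rnorm (t%:C *: (1 : A) - a) <= t.
Proof.
move=> ha at_; have t0 := le_trans (rnorm_ge0 a) at_.
split=> [[_ pa]|ta].
  apply: rnorm_le_spectrum => // [|k /spectrum_sub tk].
    exact: self_adjoint_real_sub.
  have := spectrum_norm tk; have := pa _ tk; rewrite /= lecE /=.
  case: k {tk} => r s /=; rewrite add0r oppr_eq0 => /andP[/eqP -> tr].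
  by rewrite oppr0 expr0n !addr0 !sqrtr_sqr ger0_norm// ler_norml; lra.
split=> // k ak; have := spectrum_self_adjoint_real ha ak.
have /spectrum_norm : spectrum (t%:C *: (1 : A) - a) (t%:C - k).
  by apply/spectrum_sub; rewrite subKr.
case: k {ak} => r s /= + s0; rewrite s0 subr0 expr0n addr0 sqrtr_sqr lecE /=.
by rewrite eqxx ler_norml; lra.
Qed.

Lemma positiveD a b : positive a -> positive b -> positive (a + b).
Proof.
move=> pa pb; have [[ha _] [hb _]] := (pa, pb).
have hab : self_adjoint (a + b) by rewrite /self_adjoint starD ha hb.
(* Here [t] is [rnorm a + rnorm b], so the triangle inequality splits the goal. *)
apply/(positiveP hab (rnormD a b)).
have := (positiveP ha (lexx _)).1 pa; have := (positiveP hb (lexx _)).1 pb.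
rewrite rmorphD scalerDl opprD addrACA => tb ta.
by rewrite (le_trans (rnormD _ _))// lerD.
Qed.

Lemma rnorm_sub_positive a t : self_adjoint a -> rnorm a <= t ->
  positive (t%:C *: (1 : A) - a).
Proof.
move=> ha at_; split=> [|k tk]; first exact: self_adjoint_real_sub.
have /spectrum_sub ak := tk; have := spectrum_norm ak.
have := spectrum_self_adjoint_real ha ak.
case: k {tk ak} => r s /=; rewrite add0r => /eqP; rewrite oppr_eq0 => /eqP ->.
by rewrite oppr0 expr0n addr0 sqrtr_sqr ler_norml lecE /= eqxx; lra.
Qed.

(** [rnorm b - a = (rnorm b - b) + (b - a)] is positive, so the spectrum of [a] lies in
    [[0, rnorm b]]. *)
Lemma rnorm_le_positive a b : positive a -> positive (b - a) ->
  rnorm a <= rnorm b.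
Proof.
move=> pa pba; have [[ha pa'] [hba _]] := (pa, pba).
have hb : self_adjoint b.
  by rewrite -[b](subrK a) /self_adjoint starD ha hba.
have [_ pta] := positiveD (rnorm_sub_positive hb (lexx _)) pba.
apply: (rnorm_le_spectrum ha (rnorm_ge0 b)) => k ak.
have /pta : spectrum ((rnorm b)%:C *: (1 : A) - b + (b - a)) ((rnorm b)%:C - k).
  by rewrite addrA subrK; apply/spectrum_sub; rewrite subKr.
have := pa' _ ak; rewrite /= !lecE /=.
case: k {ak} => r s /= /andP[/eqP -> r0] /andP[_ rb].
by rewrite expr0n addr0 sqrtr_sqr ger0_norm//; lra.
Qed.

End Positivity.

(** * Transfer to the C*-algebra valued metric *)

Theorem theorem2p3 (R : realType) (A : cstarAlgType R) (X : Type)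
  (hX : inhabited X) (d : X -> X -> A) (hd : cstar_metric d)
  (hcomplete : cstar_complete d) (T : X -> X) (hT : cstar_contraction d T) :
  exists! p : X, T p = p.
Proof.
have [d_ge0 d_eq0 d_sym d_tri] := hd.
have pd x y : positive (d x y) by have := d_ge0 x y; rewrite /cstar_le subr0.
have [a [a1 ha]] := hT.
have a0 := rnorm_ge0 a.
apply: (@banach_fixed_point_dist R X (fun x y => rnorm (d x y))
  _ _ _ _ _ T (rnorm a ^+ 2)) => //.
- by move=> x y; exact: rnorm_ge0.
- by move=> x y; rewrite rnorm_eq0.
- by move=> x y; rewrite d_sym.
- move=> x y z; apply: le_trans (rnormD _ _).
  exact: rnorm_le_positive (d_tri x y z).
- by rewrite sqr_ge0.
- by nra.
move=> x y; apply: (le_trans (rnorm_le_positive (pd _ _) (ha x y))).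
rewrite (le_trans (rnormM _ _))// expr2 mulrAC ler_wpM2r//.
by rewrite (le_trans (rnormM _ _))// rnorm_star.
Qed.
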